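(* Let $Q$ be a $\sigma$-bqo poset and for each $q\in Q$ let $P_q$ be a $\sigma$-bqo poset. Then the lexicographic sum $\Sigma_{q\in Q}P_q$ is $\sigma$-bqo.
   Context: The lexicographic sum $\Sigma_{q\in Q}P_q$ is the set $\{(q,p): q\in Q, p\in P_q\}$ ordered by $(q,p)\le(q',p')$ iff $q<_Q q'$, or $q=q'$ and $p\le_{P_q}p'$. A poset is wqo if it has no infinite antichain and no infinite strictly decreasing sequence. A barrier is an infinite set $B\subseteq[\omega]^{<\omega}$ which is an antichain under $\subseteq$ and such that every infinite subset of $\bigcup B$ has an initial segment (set of its $k$ smallest elements, some $k$) in $B$. For nonempty finite $r,s\subseteq\omega$, $r\triangleleft s$ means $\min r<\min s$ and $r\setminus\{\min r\}$ is a proper initial segment of $s$. A map $f:B\to P$ from a barrier is good if there are $s\triangleleft t$ in $B$ with $f(s)\le_P f(t)$; $P$ is bqo if every map from a barrier into $P$ is good. A poset is $\sigma$-bqo if it is wqo and is a union of countably many subsets each of which is bqo with the induced order. *)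

(* Defs.v *)
From mathcomp Require Import all_boot all_order finmap.
From mathcomp Require Import mathcomp_extra boolp classical_sets functions.
From mathcomp Require Import cardinality.

Set Implicit Arguments.
Unset Strict Implicit.
Unset Printing Implicit Defensive.

Local Open Scope classical_set_scope.

Definition antichain (T : Type) (R : rel T) (A : set T) : Prop :=
  forall x y, A x -> A y -> R x y -> x = y.

(* [s] consists of the #|s| smallest elements of [X]. *)
Definition initial_segment (s : {fset nat}) (X : set nat) : Prop :=
  [set` s] `<=` X /\ (forall x y, x \in s -> X y -> y \notin s -> x < y).

Definition proper_initial_segment (s t : {fset nat}) : Prop :=
  initial_segment s [set` t] /\ s <> t.

Record barrier (B : set {fset nat}) : Prop := Barrier {
  barrier_infinite : infinite_set B;
  barrier_antichain : antichain (fun s t => (s `<=` t)%fset) B;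
  barrier_initial : forall X : set nat, infinite_set X ->
    X `<=` \bigcup_(s in B) [set` s] ->
    exists2 s, B s & initial_segment s X }.

Definition is_min (m : nat) (s : {fset nat}) : Prop :=
  m \in s /\ (forall x, x \in s -> m <= x).

(* Having a minimum forces both sets to be nonempty. *)
Definition triangle (r s : {fset nat}) : Prop :=
  exists m n, [/\ is_min m r, is_min n s, m < n &
                  proper_initial_segment (r `\ m)%fset s].

Section Posets.
Context {d : Order.disp_t} {T : porderType d}.

Definition good (B : set {fset nat}) (f : {fset nat} -> T) : Prop :=
  exists s t, [/\ B s, B t, triangle s t & (f s <= f t)%O].

(* The subset [A], with the induced order, is bqo. A map B -> A is given by a
   total function whose values outside B are irrelevant; as a barrier is
   nonempty, this loses no map even when [T] is empty. *)
Definition bqo (A : set T) : Prop :=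
  forall B, barrier B ->
  forall f : {fset nat} -> T, f @` B `<=` A -> good B f.

End Posets.

Definition wqo {d : Order.disp_t} (T : porderType d) : Prop :=
  ~ (exists A : set T, infinite_set A /\ antichain (fun x y => (x <= y)%O) A)
  /\ ~ (exists u : nat -> T, forall n, (u n.+1 < u n)%O).

Definition sigma_bqo {d : Order.disp_t} (T : porderType d) : Prop :=
  wqo T /\
  exists C : set (set T),
    [/\ countable C, (forall A, C A -> bqo A) & \bigcup_(A in C) A = setT].

(* The lexicographic sum is the sigma type {q : Q & P q} with the order of
   Order.SigmaOrder; this lemma unfolds that order. *)
Lemma le_lexsum (d d' : Order.disp_t) (Q : porderType d)
    (P : Q -> porderType d') (q q' : Q) (p : P q) (p' : P q') :
  (existT (fun q => P q) q p <= existT (fun q => P q) q' p')%O <->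
  (q < q')%O \/
  exists e : q = q', (ecast x (P x) e p <= p')%O.
Proof.
rewrite Order.SigmaOrder.leEsig /=; split.
- case/andP; rewrite Order.POrderTheory.le_eqVlt => /orP[/eqP e|lt]; last by left.
  case: _ / e p' => p' /=; rewrite Order.POrderTheory.lexx tagged_asE /= => h.
  by right; exists erefl.
- case=> [lt|[e]].
    by rewrite (Order.POrderTheory.ltW lt) Order.POrderTheory.lt_geF.
  by case: _ / e p' => p' /=; rewrite Order.POrderTheory.lexx tagged_asE.
Qed.

(* Main.v *)
Require Import Defs.
From mathcomp Require Import all_boot all_order finmap zify.
From mathcomp Require Import mathcomp_extra boolp classical_sets functions.
From mathcomp Require Import cardinality.

Set Implicit Arguments.
Unset Strict Implicit.
Unset Printing Implicit Defensive.

Local Open Scope classical_set_scope.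

(** The order part is routine, and the sum is covered by the countably many
    pieces {(q, p) : q in A_n, p in C_(q,m)} with all the A_n and C_(q,m) bqo;
    so the point is that a lexicographic sum of bqo sets over a bqo set is bqo.
    Given f = (q, p) on a barrier B, a Ramsey argument gives an infinite X such
    that either q(s) = q(t) for all s <| t in B|X, or for none. In the second
    case, q being good on B|X yields q(s) < q(t) for some s <| t. In the first
    case q is constant on B|X, since any two elements of B|X are linked through
    a common tail of X, and p is good on B|X. *)

(** * Finite and infinite sets of natural numbers *)

Lemma fset_ltn_bound (s : {fset nat}) : exists n, forall x, x \in s -> x < n.
Proof.
exists (\max_(x <- s) x).+1 => x xs; rewrite ltnS.
exact: leq_bigmax_seq.
Qed.

Lemma infinite_natP (X : set nat) :
  infinite_set X <-> forall n, exists2 x, X x & n <= x.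
Proof.
split=> [infX n|unbX /finite_fsetP[s sX]].
  apply: contrapT => h; apply: infX; apply: (sub_finite_set _ (finite_II n)).
  by move=> x Xx /=; rewrite ltnNge; apply/negP => nx; apply: h; exists x.
have [n ns] := fset_ltn_bound s; have [x] := unbX n.
by rewrite sX /= => /ns; lia.
Qed.

Lemma nat_set_min (X : set nat) : X !=set0 ->
  exists2 m, X m & forall x, X x -> m <= x.
Proof.
move=> [x0 Xx0].
have ex : exists n, `[< X n >] by exists x0; apply/asboolP.
case: (ex_minnP ex) => m /asboolP Xm min_m; exists m => // x Xx.
by apply: min_m; apply/asboolP.
Qed.

Definition above (n : nat) (Z : set nat) : set nat := [set z | Z z /\ n < z].

(** Removal of the minimum, phrased without naming it, so that whether [z] belongs depends only on
    [Z] up to [z]. *)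
Definition behead_set (Z : set nat) : set nat :=
  [set z | Z z /\ exists2 y, Z y & y < z].

Lemma infinite_above n Z : infinite_set Z -> infinite_set (above n Z).
Proof.
move=> /infinite_natP infZ; apply/infinite_natP => k.
by have [x Zx lex] := infZ (k + n.+1); exists x; [split=> //|]; lia.
Qed.

Lemma behead_setE Z m : (forall x, Z x -> m <= x) -> Z m ->
  behead_set Z = above m Z.
Proof.
move=> minm Zm; apply/seteqP; split=> z [Zz].
  by case=> y /minm ? ?; split=> //; lia.
by move=> mz; split=> //; exists m.
Qed.

Lemma infinite_behead_set Z : infinite_set Z -> infinite_set (behead_set Z).
Proof.
move=> infZ; have [m Zm minm] := nat_set_min (infinite_setN0 infZ).
by rewrite (behead_setE minm Zm); exact: infinite_above.
Qed.

(** * Ramsey property of clopen families of infinite sets *)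

(** Asking this inside every infinite subset of [A] makes the property hereditary, so a construction
    may shrink its set repeatedly. *)
Definition homogenizable (A : set nat) (D : set nat -> Prop) : Prop :=
  forall X, infinite_set X -> X `<=` A ->
  exists Y (b : Prop), [/\ infinite_set Y, Y `<=` X &
    forall Z, infinite_set Z -> Z `<=` Y -> (D Z <-> b)].

Definition section_at (n : nat) (D : set nat -> Prop) : set nat -> Prop :=
  fun Z => D (n |` above n Z).

Lemma homogenizable_sections A D m :
  (forall n, A n -> m <= n -> homogenizable A (section_at n D)) ->
  homogenizable A D.
Proof.
move=> hD X infX XA.
pose state (Y : set nat) :=
  [/\ infinite_set Y, Y `<=` A & forall y, Y y -> m <= y].
(* The triple returned when [Y] is not a state is a dummy that makes the step total, as [choice]
   requires. *)
have step (Y : set nat) : exists r : nat * set nat * bool, state Y ->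
    [/\ Y r.1.1, state r.1.2, r.1.2 `<=` above r.1.1 Y &
      forall Z, infinite_set Z -> Z `<=` r.1.2 ->
        (section_at r.1.1 D Z <-> r.2)].
  have [[infY YA Ym]|nY] := pselect (state Y); last by exists (0, Y, false).
  have [x Yx] := infinite_setN0 infY.
  have aA : above x Y `<=` A by move=> z [/YA].
  have [Y' [b [infY' Y'Y hb]]] :=
    hD x (YA _ Yx) (Ym _ Yx) _ (infinite_above (n := x) infY) aA.
  exists (x, Y', `[< b >]) => _; split=> //=.
    split=> // z /Y'Y; first exact: aA.
    by case=> /Ym.
  by move=> Z infZ ZY'; rewrite hb //; split=> /asboolP.
have [F hF] := choice step.
pose Y_ k := iter k (fun Y => (F Y).1.2) (above m X).
have Yst k : state (Y_ k).
  elim: k => [|k /hF[]//]; split; first exact: infinite_above.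
    by move=> z [/XA].
  by move=> z [_ /ltnW].
pose x_ k := (F (Y_ k)).1.1; pose b_ k := (F (Y_ k)).2.
have Yx k : Y_ k (x_ k) by have [] := hF _ (Yst k).
have YS k : Y_ k.+1 `<=` above (x_ k) (Y_ k) by have [] := hF _ (Yst k).
have Yb k Z : infinite_set Z -> Z `<=` Y_ k.+1 ->
    (section_at (x_ k) D Z <-> b_ k).
  by have [_ _ _] := hF _ (Yst k); apply.
have Ymono i k : Y_ (i + k) `<=` Y_ i.
  elim: k => [|k IH]; first by rewrite addn0.
  by rewrite addnS => z /YS[/IH].
have xmono i j : i < j -> x_ i < x_ j.
  move=> ij; have /Ymono/YS[] // : Y_ (i.+1 + (j - i.+1)) (x_ j).
  by rewrite subnKC.
have xle k : k <= x_ k.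
  by elim: k => // k IH; apply: leq_ltn_trans IH (xmono _ _ (ltnSn k)).
have [b hb] : exists b, infinite_set [set k | b_ k = b].
  apply: contrapT => h; apply: infinite_nat.
  have fin b : finite_set [set k | b_ k = b].
    by apply: contrapT => ?; apply: h; exists b.
  apply: sub_finite_set (_ : finite_set
    ([set k | b_ k = true] `|` [set k | b_ k = false])).
    by move=> k _ /=; case: (b_ k); [left|right].
  by rewrite finite_setU.
exists (x_ @` [set k | b_ k = b]), b; split.
- apply/infinite_natP => n; have /infinite_natP/(_ n)[k hk nk] := hb.
  by exists (x_ k); [exists k|apply: leq_trans (xle k)].
- by move=> _ [k _ <-]; have /(Ymono 0 k)[] := Yx k.
move=> Z infZ ZY; have [z Zz minz] := nat_set_min (infinite_setN0 infZ).
have [k /= kb kz] := ZY _ Zz.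
(* [Z] is its minimum [x_ k] followed by a subset of [Y_ k.+1], where the section at [x_ k] has the
   constant value [b_ k]. *)
have -> : D Z = section_at (x_ k) D (above z Z).
  rewrite /section_at kz; congr D; apply/seteqP; split=> w /=.
    move=> Zw; have := minz _ Zw; rewrite leq_eqVlt => /orP[/eqP->|zw].
      by left.
    by right; split=> //; split.
  by case=> [->|[[]]].
rewrite -kb; apply: Yb; first exact: infinite_above.
move=> w [Zw zw]; have [j _ jw] := ZY _ Zw.
have kj : k < j.
  rewrite ltnNge leq_eqVlt; apply/negP => /orP[/eqP|/xmono]; last by lia.
  by move=> jk; move: zw; rewrite -jw -kz jk ltnn.
rewrite -jw; apply: (Ymono k.+1 (j - k.+1)); rewrite subnKC //.
Qed.

Definition agree_below (m : nat) (X Z : set nat) : Prop :=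
  forall i, i < m -> (X i <-> Z i).

(** Local constancy in the topology that the infinite subsets of [A] inherit from the Cantor
    space. *)
Definition clopen_on (A : set nat) (D : set nat -> Prop) : Prop :=
  forall X, infinite_set X -> X `<=` A -> exists m, forall Z,
    infinite_set Z -> Z `<=` A -> agree_below m X Z -> (D X <-> D Z).

(* Otherwise [homogenizable_sections] yields increasing n_0 < n_1 < ... none of
   whose iterated sections is homogenizable; but the sections of a clopen [D]
   along {n_0, n_1, ...} are eventually constant. *)
Lemma clopen_homogenizable A D : clopen_on A D -> homogenizable A D.
Proof.
move=> clD; apply: contrapT => nhD.
have step (E : nat * (set nat -> Prop)) : exists n, ~ homogenizable A E.2 ->
    [/\ A n, E.1 <= n & ~ homogenizable A (section_at n E.2)].
  have [h|nh] := pselect (homogenizable A E.2); first by exists 0.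
  apply: contrapT => no; apply: nh; apply: (@homogenizable_sections _ _ E.1).
  move=> n An En; apply: contrapT => nhn; apply: no; exists n => _.
  by split.
have [F hF] := choice step.
(* The first component is the lower bound for the next point; its successor makes the [x_ k]
   strictly increasing. *)
pose E_ k := iter k (fun E => ((F E).+1, section_at (F E) E.2)) (0, D).
have nhE k : ~ homogenizable A (E_ k).2.
  by elim: k => [//|k /hF[]].
pose x_ k := F (E_ k).
have Ax k : A (x_ k) by have [] := hF _ (nhE k).
have xS k : x_ k < x_ k.+1 by have [] := hF _ (nhE k.+1).
have xmono i j : i < j -> x_ i < x_ j.
  elim: j => // j IH; rewrite ltnS leq_eqVlt => /orP[/eqP->//|/IH ij].
  exact: ltn_trans ij (xS j).
have xle k : k <= x_ k.
  by elim: k => // k IH; apply: leq_ltn_trans IH (xS k).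
have EE k Z : (E_ k.+1).2 Z =
    D ([set w | exists2 i, i <= k & w = x_ i] `|` above (x_ k) Z).
  elim: k Z => [|k IH] Z.
    rewrite /= /section_at; congr D; congr (_ `|` _); apply/seteqP.
    by split=> w /=; [move=> ->; exists 0|case=> [[|]]].
  rewrite (_ : (E_ k.+2).2 Z = (E_ k.+1).2 (x_ k.+1 |` above (x_ k.+1) Z)) //.
  rewrite IH; congr D; apply/seteqP; split=> w /=.
    move=> [[i ik ->]|[[->|[Zw xw]] xkw]].
    - by left; exists i; rewrite // ltnW.
    - by left; exists k.+1.
    - by right; split.
  move=> [[i]|[Zw xw]].
    rewrite leq_eqVlt => /orP[/eqP-> ->|]; last by move=> ik ->; left; exists i.
    by right; split; [left|].
  by right; split; [right; split|apply: ltn_trans xw].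
have infX : infinite_set (range x_).
  by apply/infinite_natP => n; exists (x_ n).
have XA : range x_ `<=` A by move=> _ [k _ <-].
have [m hm] := clD _ infX XA.
(* Since [m <= x_ m], every set that starts with the points [x_ 0], ..., [x_ m] agrees with
   [range x_] below [m]. Hence the section at stage [m.+1] is constant, so homogenizable. *)
apply: (nhE m.+1) => Y infY YA; exists Y, (D (range x_)); split=> // Z infZ ZY.
rewrite EE; apply: iff_sym; apply: hm.
- exact: sub_infinite_set (@subsetUr _ _ _) (infinite_above infZ).
- by move=> w [[i _ ->]//|[/ZY/YA]].
move=> i im; split=> [[j _ ji]|[[j _ ->]|[_ xi]]].
  by left; exists j => //; have := xle j; lia.
  by exists j.
by have := leq_ltn_trans (xle m) (ltn_trans xi im); rewrite ltnn.
Qed.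

(** * Barriers, their restrictions and the triangle relation *)

Definition base (B : set {fset nat}) : set nat := \bigcup_(s in B) [set` s].

Definition restriction (B : set {fset nat}) (X : set nat) : set {fset nat} :=
  [set s | B s /\ [set` s] `<=` X].

Lemma finite_base B : finite_set (base B) -> finite_set B.
Proof.
move=> /finite_fsetP[U BU].
apply: (sub_finite_set _ (finite_fset (fpowerset U))) => s Bs /=.
rewrite fpowersetE; apply/fsubsetP => x xs.
by have : base B x by [exists s]; rewrite BU.
Qed.

(** The empty set lies below every element, so an antichain containing it is a singleton, hence
    finite. *)
Lemma barrier_neq0 B s : barrier B -> B s -> exists x, x \in s.
Proof.
move=> barB Bs; apply: contrapT => h; apply: (barrier_infinite barB).
apply: (sub_finite_set _ (finite_set1 s)) => t Bt /=; apply/esym.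
apply: (barrier_antichain barB Bs Bt); apply/fsubsetP => x xs.
by case: h; exists x.
Qed.

Lemma initial_segment_comparable s t X :
  initial_segment s X -> initial_segment t X ->
  (s `<=` t)%fset \/ (t `<=` s)%fset.
Proof.
move=> [sX s_lt] [tX t_lt]; apply: contrapT => /not_orP[].
move=> /negP/fsubsetPn[a a_s a_t] /negP/fsubsetPn[b b_t b_s].
have := s_lt a b a_s (tX _ b_t) b_s; have := t_lt b a b_t (sX _ a_s) a_t.
by lia.
Qed.

Lemma barrier_initial_inj B s t X : barrier B -> B s -> B t ->
  initial_segment s X -> initial_segment t X -> s = t.
Proof.
move=> barB Bs Bt sX tX; have [st|ts] := initial_segment_comparable sX tX.
  exact: barrier_antichain barB _ _ _ _ st.
by apply/esym; exact: barrier_antichain barB _ _ _ _ ts.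
Qed.

(** For infinity: if the restriction were finite, its base would be bounded by some [n], yet a
    barrier element starting [above n X] is nonempty and lies beyond [n]. *)
Lemma barrier_restriction B X : barrier B -> infinite_set X ->
  X `<=` base B -> barrier (restriction B X).
Proof.
move=> barB infX XB; split.
- move=> finBX.
  have /finite_fsetP[U BU] : finite_set (base (restriction B X)).
    by apply: bigcup_finite => // s _; exact: finite_fset.
  have [n ltn] := fset_ltn_bound U.
  have [|s Bs [sX _]] := barrier_initial barB (infinite_above (n := n) infX).
    by move=> x [/XB].
  have [x xs] := barrier_neq0 barB Bs; have [Xx nx] := sX _ xs.
  have : base (restriction B X) x.
    by exists s => //; split=> // y /sX[].
  by rewrite BU => /ltn; lia.
- by move=> s t [Bs _] [Bt _]; exact: (barrier_antichain barB Bs Bt).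
move=> Y infY YB.
have YX : Y `<=` X by move=> y /YB[s [_ sX] /sX].
have [s Bs sY] := barrier_initial barB infY (subset_trans YX XB).
by exists s => //; split=> //; exact: subset_trans (sY.1) YX.
Qed.

(** With [triangle_initial], this turns pairs [s <| t] into infinite sets. Both [s] minus its
    minimum and [t] start [behead_set X], so they are comparable; the antichain property rules out
    that [t] is the smaller or equal one. *)
Lemma initial_triangle B X s t : barrier B -> infinite_set X -> B s -> B t ->
  initial_segment s X -> initial_segment t (behead_set X) -> triangle s t.
Proof.
move=> barB infX Bs Bt [sX s_lt] tX'; have [tX t_lt] := tX'.
have [m Xm minm] := nat_set_min (infinite_setN0 infX).
have bX := behead_setE minm Xm.
have ms : m \in s.
  have [x xs] := barrier_neq0 barB Bs.
  case: (boolP (m \in s)) => // /(s_lt x m xs Xm).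
  by have := minm _ (sX _ xs); lia.
have [n nt minn] := nat_set_min (X := [set` t]) (barrier_neq0 barB Bt).
have mn : m < n by have := tX _ nt; rewrite bX => -[].
have sm : initial_segment (s `\ m)%fset (behead_set X).
  split=> [x /=|x y]; rewrite bX !inE.
    move=> /andP[xm xs]; split; first exact: sX.
    by have := minm _ (sX _ xs); lia.
  move=> /andP[xm xs] [Xy my]; rewrite negb_and => /orP[|]; first by lia.
  exact: s_lt.
exists m, n; split=> //.
- by split=> // x /sX/minm.
have m_t : m \notin t.
  by apply/negP => /tX; rewrite bX => -[_]; rewrite ltnn.
have [smt|/fsubsetP tsm] := initial_segment_comparable sm tX'; last first.
  have ts : (t `<=` s)%fset.
    by apply/fsubsetP => x /tsm; rewrite !inE => /andP[].
  by move: m_t; rewrite (barrier_antichain barB Bt Bs ts) ms.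
split.
- split; first by move=> x /(fsubsetP smt).
  by move=> x y xs /= yt ys; apply: sm.2 ys => //; exact: tX.
move=> e; have st : (s `<=` t)%fset.
  (* s \ m = t is impossible, as then t would be a proper subset of s. *)
  have ts : (t `<=` s)%fset by rewrite -e; exact: fsubD1set.
  by rewrite (barrier_antichain barB Bt Bs ts).
by move: m_t; rewrite (fsubsetP st).
Qed.

Lemma triangle_initial X s t : infinite_set X -> triangle s t ->
  [set` s] `<=` X -> [set` t] `<=` X ->
  exists Z, [/\ infinite_set Z, Z `<=` X, initial_segment s Z &
                initial_segment t (behead_set Z)].
Proof.
move=> infX [m [n [[ms minm] [nt minn] mn [[smt sm_lt] _]]]] sX tX.
have [k tk] := fset_ltn_bound t.
(* The minimum of [s], then [t], then a tail of [X] beyond [t]. *)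
pose Z := m |` ([set` t] `|` above k X).
have mk : m < k by have := tk _ nt; lia.
have mt x : x \in t -> m < x by move=> /minn; lia.
have minZ x : Z x -> m <= x.
  by case=> [->//|[/mt|[_]]]; lia.
have bZ : behead_set Z = [set` t] `|` above k X.
  rewrite (behead_setE minZ); last by left.
  apply/seteqP; split=> [x [[->|//]]|x hx]; first by rewrite ltnn.
  by split; [right|case: hx => [/mt//|[_]]; lia].
have st x : x \in s -> x <> m -> x \in t.
  by move=> xs xm; apply: smt; rewrite /= !inE xs andbT; apply/eqP.
exists Z; split.
- apply/infinite_natP => j; have /infinite_natP/(_ (j + k.+1))[x Xx jx] := infX.
  by exists x; [right; right; split=> //|]; lia.
- by move=> x [->|[/tX//|[]//]]; exact: sX.
- split.
    move=> x /= xs; have [->|xm] := pselect (x = m); first by left.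
    by right; left; exact: st.
  move=> x y xs hy ys; have [xm|xm] := pselect (x = m).
    have := minZ _ hy; rewrite leq_eqVlt xm => /orP[/eqP e|//].
    by move: ys; rewrite -e ms.
  case: hy => [e|[/= yt|[_ ky]]]; first by move: ys; rewrite e ms.
    apply: sm_lt => //; rewrite !inE ?xs ?(negbTE ys) ?andbF// andbT.
    exact/eqP.
  exact: ltn_trans (tk _ (st _ xs xm)) ky.
rewrite bZ; split; first by move=> x ?; left.
by move=> x y xt [/= ->//|[_ ky]] _; exact: ltn_trans (tk _ xt) ky.
Qed.

(** * A Ramsey theorem for pairs in a barrier, and connectedness *)

Lemma initial_segment_agree m s X Z : (forall x, x \in s -> x < m) ->
  agree_below m X Z -> initial_segment s X -> initial_segment s Z.
Proof.
move=> sm XZ [sX s_lt]; split=> [x xs|x y xs Zy ys].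
  by apply/XZ; [exact: sm|exact: sX].
have [ym|my] := ltnP y m; first by apply: s_lt => //; apply/XZ.
exact: leq_trans (sm _ xs) my.
Qed.

Lemma agree_below_behead m X Z : agree_below m X Z ->
  agree_below m (behead_set X) (behead_set Z).
Proof.
by move=> XZ i im; split=> -[Xi [y Xy yi]]; (split; first exact/XZ);
  exists y => //; apply/(XZ y) => //; exact: ltn_trans im.
Qed.

Lemma behead_sub X : behead_set X `<=` X. Proof. by move=> x []. Qed.

(* The form of Nash-Williams' partition theorem needed here: it concerns the
   barrier of all unions of s and t with s <| t, but is stated on the pairs. *)
Lemma barrier_ramsey B (R : {fset nat} -> {fset nat} -> Prop) : barrier B ->
  exists X, [/\ infinite_set X, X `<=` base B &
    (forall s t, restriction B X s -> restriction B X t -> triangle s t ->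
       R s t) \/
    (forall s t, restriction B X s -> restriction B X t -> triangle s t ->
       ~ R s t)].
Proof.
move=> barB.
(* An infinite [Z] inside [base B] determines one pair, the barrier elements starting [Z] and
   [behead_set Z]; [D] colours [Z] by [R] on that pair. It is clopen since a bound for [s] and [t]
   decides it. *)
pose D Z := exists s t, [/\ B s, B t, initial_segment s Z,
  initial_segment t (behead_set Z) & R s t].
have DE Z s t : B s -> B t -> initial_segment s Z ->
    initial_segment t (behead_set Z) -> (D Z <-> R s t).
  move=> Bs Bt sZ tZ; split=> [[s' [t' [Bs' Bt' sZ' tZ' r]]]|]; last first.
    by exists s, t.
  by rewrite (barrier_initial_inj barB Bs Bs' sZ sZ')
             (barrier_initial_inj barB Bt Bt' tZ tZ').
have infB : infinite_set (base B).
  by move=> /finite_base; exact: barrier_infinite.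
have clD : clopen_on (base B) D.
  move=> X infX XB; have [s Bs sX] := barrier_initial barB infX XB.
  have [t Bt tX] := barrier_initial barB (infinite_behead_set infX)
    (subset_trans (@behead_sub X) XB).
  have [m stm] := fset_ltn_bound (s `|` t)%fset; exists m => Z infZ ZB XZ.
  rewrite (DE X s t)// (DE Z s t)//.
    by apply: initial_segment_agree XZ sX => x xs; apply: stm; rewrite inE xs.
  apply: initial_segment_agree (agree_below_behead XZ) tX => x xt.
  by apply: stm; rewrite inE xt orbT.
have [X [b [infX XB hX]]] := clopen_homogenizable clD infB (@subset_refl _ _).
exists X; split=> //.
have Rb s t : restriction B X s -> restriction B X t -> triangle s t ->
    (R s t <-> b).
  move=> [Bs sX] [Bt tX] /(triangle_initial infX)/(_ sX tX).
  by case=> Z [infZ ZX sZ tZ]; rewrite -(DE Z s t)//; exact: hX.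
by have [hb|hb] := pselect b; [left|right] => s t Bs Bt /(Rb _ _ Bs Bt) ->.
Qed.

(* Deleting least elements one at a time leads from an infinite set starting
   with [s] to a common tail, each step being a pair s' <| s''. *)
Lemma triangle_invariant_constant (T : Type) B (phi : {fset nat} -> T) :
  barrier B ->
  (forall s t, B s -> B t -> triangle s t -> phi s = phi t) ->
  forall s t, B s -> B t -> phi s = phi t.
Proof.
move=> barB inv.
have infB : infinite_set (base B).
  by move=> /finite_base; exact: barrier_infinite.
(* Induction on [n]: passing from [above n X] to [above n.+1 X] deletes the minimum if [n.+1] is in
   [X], and changes nothing otherwise. *)
have tail n X s t : infinite_set X -> X `<=` base B -> B s -> B t ->
    initial_segment s X -> initial_segment t (above n X) -> phi s = phi t.
  move=> infX XB Bs; elim: n t => [|n IH] t Bt sX tX.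
    have [X0|X0] := pselect (X 0).
      rewrite -(@behead_setE X 0) in tX => //.
      by apply: inv => //; exact: (initial_triangle barB infX Bs Bt sX tX).
    rewrite (_ : above 0 X = X) in tX.
      by rewrite (barrier_initial_inj barB Bs Bt sX tX).
    by apply/seteqP; split=> [x []//|[|x] Xx //]; split.
  have infY := infinite_above (n := n) infX.
  have YB : above n X `<=` base B by move=> x [/XB].
  have [u Bu uX] := barrier_initial barB infY YB.
  rewrite (IH u Bu sX uX); have [Xn|Xn] := pselect (X n.+1).
    apply: inv => //; apply: (initial_triangle barB infY Bu Bt uX).
    rewrite (@behead_setE _ n.+1)//; last by move=> x [].
    rewrite (_ : above _ _ = above n.+1 X)//.
    apply/seteqP; split=> x; first by move=> [[]].
    by move=> [Xx nx]; split=> //; split=> //; lia.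
  rewrite (_ : above n.+1 X = above n X) in tX.
    by rewrite (barrier_initial_inj barB Bu Bt uX tX).
  apply/seteqP; split=> x [Xx nx]; split=> //; first by lia.
  by rewrite ltn_neqAle nx andbT; apply/eqP => e; apply: Xn; rewrite e.
(* Any [s] below [n] can be continued by the same tail of the base, so the value at [s] is that at
   the element [u] starting this tail. *)
have far n s u : B s -> B u -> (forall x, x \in s -> x < n) ->
    initial_segment u (above n (base B)) -> phi s = phi u.
  move=> Bs Bu sn uB; pose Z := [set` s] `|` above n (base B).
  have aZ : above n Z = above n (base B).
    apply/seteqP; split=> x; last by move=> [? ?]; split=> //; right.
    by case=> [[/sn|//]]; lia.
  apply: (@tail n Z) => //; last by rewrite aZ.
  - exact: sub_infinite_set (@subsetUr _ _ _) (infinite_above infB).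
  - by move=> x [xs|[]//]; exists s.
  split; first exact: subsetUl.
  by move=> x y xs [/= ->//|[_ ny]] _; exact: ltn_trans (sn _ xs) ny.
move=> s t Bs Bt; have [n stn] := fset_ltn_bound (s `|` t)%fset.
have [|u Bu uB] := barrier_initial barB (infinite_above (n := n) infB).
  by move=> x [].
rewrite (far n s u)// ?(far n t u)// => x xs.
  by apply: stn; rewrite inE xs orbT.
by apply: stn; rewrite inE xs.
Qed.

(** * Lexicographic sums of bqo sets and of wqo posets *)

Section LexSum.
Import Order.POrderTheory.
Context {d d' : Order.disp_t} {Q : porderType d} {P : Q -> porderType d'}.
Implicit Types (x y : {q : Q & P q}).

Lemma le_tag x y : (x <= y)%O -> (tag x <= tag y)%O.
Proof. by rewrite leEsig => /andP[]. Qed.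

Lemma lt_tag_lt x y : (tag x < tag y)%O -> (x < y)%O.
Proof. by move=> xy; rewrite ltEsig (ltW xy) lt_geF. Qed.

Lemma le_Tagged q (p p' : P q) :
  (existT P q p <= existT P q p')%O = (p <= p')%O.
Proof. by rewrite leEsig /= lexx tagged_asE. Qed.

Lemma lt_Tagged q (p p' : P q) :
  (existT P q p < existT P q p')%O = (p < p')%O.
Proof. by rewrite ltEsig /= lexx tagged_asE. Qed.

Lemma bqo_lexsum (A : set Q) (C : forall q, set (P q)) :
  bqo A -> (forall q, bqo (C q)) ->
  bqo [set x : {q : Q & P q} | A (tag x) /\ C (tag x) (tagged x)].
Proof.
move=> bqoA bqoC B barB f fAC.
have fB s : B s -> A (tag (f s)) /\ C (tag (f s)) (tagged (f s)).
  by move=> Bs; apply: fAC; exists s.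
have [X [infX XB hX]] := barrier_ramsey (fun s t => tag (f s) = tag (f t)) barB.
have barX := barrier_restriction barB infX XB.
case: hX => [eq_tag|neq_tag]; last first.
  have [|s [t [Bs Bt st fst]]] := bqoA _ barX (fun s => tag (f s)).
    by move=> _ [s [/fB[As _] _] <-].
  exists s, t; split=> //; [exact: Bs.1|exact: Bt.1|].
  apply/ltW/lt_tag_lt.
  rewrite lt_neqAle fst andbT.
  by apply/eqP; exact: neq_tag.
have cst := triangle_invariant_constant barX eq_tag.
have [s0 Bs0] := infinite_setN0 (barrier_infinite barX).
(* [tagged_as] transports the second component of [f s] to the fibre of [f s0]; its default for
   unequal tags never occurs on the restriction. *)
have fE s : restriction B X s ->
    f s = Tagged P (tagged_as (f s0) (f s)).
  move=> Bs; have := cst _ _ Bs0 Bs.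
  case: (f s0) (f s) => [q p] [q' p'] /= e; case: _ / e p' => p'.
  by rewrite tagged_asE.
have [|s [t [Bs Bt st le_st]]] :=
    bqoC (tag (f s0)) _ barX (fun s => tagged_as (f s0) (f s)).
  move=> _ [s Bs <-]; have [_] := fB _ Bs.1.
  by rewrite {1 2}(fE s Bs).
exists s, t; split=> //; [exact: Bs.1|exact: Bt.1|].
by rewrite (fE s Bs) (fE t Bt) le_Tagged.
Qed.

(** The tags of an antichain form an antichain, so it meets finitely many fibres, each in a finite
    set. Along a decreasing sequence the tags decrease weakly, hence stabilize, and the tail
    descends inside one fibre. *)
Lemma wqo_lexsum : wqo Q -> (forall q, wqo (P q)) -> wqo {q : Q & P q}.
Proof.
move=> [acQ decQ] wqoP; split.
  move=> [A [infA acA]]; apply: infA.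
  have fin_tag : finite_set ((fun x => tag x) @` A).
    apply: contrapT => inf; apply: acQ; exists ((fun x => tag x) @` A).
    split=> // _ _ [x Ax <-] [y Ay <-] /=.
    rewrite le_eqVlt => /orP[/eqP//|/lt_tag_lt/ltW xy].
    by rewrite (acA _ _ Ax Ay xy).
  have fin_fiber q : finite_set [set p : P q | A (Tagged P p)].
    apply: contrapT => inf; apply: (wqoP q).1; exists [set p | A (Tagged P p)].
    split=> // p p' Ap Ap' /= pp'.
    have /(acA _ _ Ap Ap')/eqP : (Tagged P p <= Tagged P p')%O.
      by rewrite le_Tagged.
    by rewrite eq_Tagged => /eqP.
  apply: sub_finite_set (bigcup_finite fin_tag
    (fun q _ => finite_image (Tagged P) (fin_fiber q))).
  by move=> [q p] Aqp; exists q; [exists (Tagged P p)|exists p].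
move=> [u decu].
have tag_mono n k : (tag (u (n + k)) <= tag (u n))%O.
  elim: k => [|k IH]; first by rewrite addn0.
  rewrite addnS; apply: le_trans IH.
  by apply/le_tag/ltW.
have [N cst] : exists N, forall k, tag (u (N + k)) = tag (u N).
  apply: contrapT => h; apply: decQ.
  have step n : exists m, (tag (u m) < tag (u n))%O.
    apply: contrapT => no; apply: h; exists n => k.
    apply/eqP; apply: contrapT => /negP ne; apply: no; exists (n + k).
    by rewrite lt_neqAle ne tag_mono.
  have [g hg] := choice step.
  by exists (fun k => tag (u (iter k g 0))) => k; exact: hg.
apply: (wqoP (tag (u N))).2; exists (fun k => tagged_as (u N) (u (N + k))) => k.
have uE j : u (N + j) = existT P _ (tagged_as (u N) (u (N + j))).
  have := cst j; move: (u N) (u (N + j)) => [q p] [q' p'] /= e.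
  by case: _ / (esym e) p' => p'; rewrite tagged_asE.
by rewrite -lt_Tagged -!uE addnS.
Qed.

End LexSum.

(** * Countable covers by bqo sets *)

Lemma bqo0 {d : Order.disp_t} {T : porderType d} : bqo (set0 : set T).
Proof.
move=> B barB f fB; have [s Bs] := infinite_setN0 (barrier_infinite barB).
by have [] := fB (f s); exists s.
Qed.

(** An injection of the family into the naturals reindexes it; the indices that are not attained get
    the empty set, which is bqo. *)
Lemma sigma_bqo_cover {d : Order.disp_t} {T : porderType d} : sigma_bqo T ->
  exists E : nat -> set T, (forall n, bqo (E n)) /\ forall x, exists n, E n x.
Proof.
move=> [_ [C [/countable_injP[idx idx_inj] bqoC coverC]]].
pose E n := \bigcup_(A in [set A | C A /\ idx A = n]) A.
have EA A : C A -> E (idx A) = A.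
  move=> CA; apply/seteqP; split=> [x [A' [CA' e] A'x]|x Ax]; last by exists A.
  by rewrite -(idx_inj A' A) ?inE.
exists E; split=> [n|x]; last first.
  have : [set: T] x by []; rewrite -coverC => -[A CA Ax].
  by exists (idx A); rewrite EA.
have [[A [CA <-]]|no] := pselect (exists A, C A /\ idx A = n).
  by rewrite EA //; exact: bqoC.
rewrite (_ : E n = set0); first exact: bqo0.
by apply/seteqP; split=> // x [A hA _]; case: no; exists A.
Qed.

Theorem mainTheorem7 (d d' : Order.disp_t) (Q : porderType d)
    (P : Q -> porderType d') (hQ : sigma_bqo Q)
    (hP : forall q : Q, sigma_bqo (P q)) :
  sigma_bqo {q : Q & P q}.
Proof.
split; first by apply: wqo_lexsum => [|q]; [case: hQ|case: (hP q)].
have [A [bqoA coverA]] := sigma_bqo_cover hQ.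
have C q := cid (sigma_bqo_cover (hP q)).
(* One index [i.2] serves all fibres simultaneously, which keeps the pieces countable in number even
   for uncountable [Q]. *)
pose S (i : nat * nat) : set {q : Q & P q} :=
  [set x | A i.1 (tag x) /\ projT1 (C (tag x)) i.2 (tagged x)].
exists (range S); split.
- exact: sub_countable (card_image_le S setT) (countableP _).
- move=> _ [[n m] _ <-].
  apply: (bqo_lexsum (C := fun q => projT1 (C q) m)) => // q.
  exact: (projT2 (C q)).1.
apply/seteqP; split=> // x _; have [n An] := coverA (tag x).
have [m Cm] := (projT2 (C (tag x))).2 (tagged x).
by exists (S (n, m)); [exists (n, m)|].
Qed.
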